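(* Let $\mathsf{Paw}$ be the graph on $4$ vertices obtained from the triangle $K_3$ by appending a leaf to one of its vertices. The set of all ordered multiplicity lists attained by matrices in $\mathcal{S}_L(\mathsf{Paw})$ is exactly $\{(1,1,1,1), (1,1,2), (1,2,1)\}$.
   Context: For a finite simple graph $G$ on $n$ vertices, $\mathcal{S}_L(G)$ denotes the set of $n\times n$ real symmetric matrices $A=[a_{i,j}]$ such that $a_{i,j}<0$ if $\{i,j\}\in E(G)$, $a_{i,j}=0$ if $i\neq j$ and $\{i,j\}\notin E(G)$, and $a_{i,i}=-\sum_{k\neq i}a_{i,k}$ for all $i$. The ordered multiplicity list of $A\in\mathcal{S}_L(G)$ is $(m_1,\ldots,m_q)$, where $\lambda_1<\lambda_2<\cdots<\lambda_q$ are the distinct eigenvalues of $A$ in increasing order and $m_i$ is the multiplicity of $\lambda_i$. *)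

(* Defs.v *)
From mathcomp Require Import all_boot all_order all_algebra.
From mathcomp Require Import reals.

Set Implicit Arguments.
Unset Strict Implicit.
Unset Printing Implicit Defensive.

Import Order.TTheory GRing.Theory Num.Theory.
Local Open Scope ring_scope.

Record sgraph (n : nat) := SGraph {
  edge :> rel 'I_n;
  edge_sym : symmetric edge;
  edge_irrefl : irreflexive edge
}.

Definition SL (R : realType) (n : nat) (G : sgraph n) (A : 'M[R]_n) : Prop :=
  [/\ A^T = A,
      forall i j, G i j -> A i j < 0,
      forall i j, i != j -> ~~ G i j -> A i j = 0
    & forall i, A i i = - \sum_(k < n | k != i) A i k].

(* Multiplicity is algebraic; for real symmetric matrices it coincides with the
   dimension of the eigenspace. *)
Definition is_ordered_mult_list (R : realType) (n : nat) (A : 'M[R]_n)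
    (m : seq nat) : Prop :=
  exists s : seq R,
    [/\ sorted <%R s,
        forall a : R, (a \in s) = eigenvalue A a
      & m = [seq mup a (char_poly A) | a <- s]].

Definition attained (R : realType) (n : nat) (G : sgraph n) (m : seq nat) : Prop :=
  exists A : 'M[R]_n, SL G A /\ is_ordered_mult_list A m.

(* Triangle on the vertices 0, 1, 2, with the leaf 3 attached to 0. *)
Definition paw_edges : seq (nat * nat) :=
  [:: (0, 1); (0, 2); (1, 2); (0, 3)]%N.

Definition paw_rel : rel 'I_4 :=
  fun i j => ((val i, val j) \in paw_edges) || ((val j, val i) \in paw_edges).

Lemma paw_sym : symmetric paw_rel.
Proof. by move=> i j; rewrite /paw_rel orbC. Qed.

Lemma paw_irrefl : irreflexive paw_rel.
Proof. by case=> [[|[|[|[|?]]]] ?]. Qed.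

Definition Paw : sgraph 4 := SGraph paw_sym paw_irrefl.

(* Main.v *)
Require Import Defs.
From mathcomp Require Import all_boot all_order all_algebra.
From mathcomp Require Import reals.
From mathcomp Require Import spectral complex ring lra.

(** A matrix in [SL Paw] is the weighted Laplacian of the paw with positive
    weights [a], [b], [c], [d] on the edges [01], [02], [12], [03].  Its
    characteristic polynomial is ['X] times the cubic
    [X^3 - e1 X^2 + e2 X - e3], where, by the matrix-tree theorem for forests,
    [e1 = 2 (a + b + c + d)], [e2 = 3 (ab + ac + bc + ad + bd) + 4 cd] and
    [e3 = 4 d (ab + ac + bc)].

    A real symmetric matrix has only real eigenvalues
    ([symmetric_char_poly_split]), so the cubic has three real roots
    [x <= y <= z].  They are positive because its coefficients alternate in
    sign, so [0] is a simple eigenvalue and the smallest one.  The three roots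
    cannot all coincide: that would force [e1 ^ 2 = 3 e2], while [e1 ^ 2 - 3 e2]
    is a positive definite quadratic form in the weights
    ([paw_laplacian_spectrum]).  Hence at most one of [x = y] and [y = z] holds,
    and the multiplicity list is one of the three announced
    ([paw_mult_listE]).

    All three cases occur.  When [a = b], the vector [(0, 1, -1, 0)] is an
    eigenvector for [a + 2 c], and the two remaining nonzero eigenvalues depend
    on [a] and [d] only.  The larger of these exceeds [a], and so does the
    smaller one when [a < d]; a suitable [c > 0] then makes [a + 2 c] equal to
    the chosen one, which doubles the largest or the middle eigenvalue. *)

Set Implicit Arguments.
Unset Strict Implicit.
Unset Printing Implicit Defensive.

Import Order.TTheory GRing.Theory Num.Theory.
Local Open Scope ring_scope.

(** * Characteristic polynomials of symmetric matrices *)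

(** Laplace expansion along the first row, on entries indexed by [nat]: minors
    of an explicit matrix are again given by an explicit function, so that a
    determinant of concrete size unfolds by computation. *)
Fixpoint laplace_det (K : comNzRingType) (n : nat) (f : nat -> nat -> K) : K :=
  if n is n'.+1 then
    \sum_(k <- iota 0 n)
      f 0%N k * ((-1) ^+ k * laplace_det n' (fun i j => f i.+1 (bump k j)))
  else 1.

Lemma det_laplaceE (K : comNzRingType) (n : nat) (f : nat -> nat -> K) :
  \det (\matrix_(i < n, j < n) f i j) = laplace_det n f.
Proof.
elim: n f => [|n IHn] f; first by rewrite det_mx00.
rewrite (expand_det_row _ ord0) /= -[_ :: _]/(index_iota 0 n.+1).
rewrite big_mkord; apply: eq_bigr => k _; rewrite mxE /cofactor add0n -IHn.
by congr (_ * (_ * \det _)); apply/matrixP=> i j; rewrite !mxE.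
Qed.

Lemma char_poly_conj (K : comUnitRingType) (n : nat) (P D : 'M[K]_n) :
  P \in unitmx -> char_poly (invmx P *m D *m P) = char_poly D.
Proof.
move=> Pu; have PVP : map_mx polyC (invmx P) *m map_mx polyC P = 1%:M.
  by rewrite -map_mxM mulVmx // map_mx1.
have -> : char_poly (invmx P *m D *m P)
  = \det (map_mx polyC (invmx P) *m char_poly_mx D *m map_mx polyC P).
  rewrite /char_poly /char_poly_mx mulmxBr mulmxBl -!map_mxM.
  by rewrite mul_mx_scalar -scalemxAl PVP scalemx1.
by rewrite !det_mulmx mulrAC -det_mulmx PVP det1 mul1r.
Qed.

(** Over [R[i]] the matrix is hermitian, hence unitarily diagonalizable with a
    real diagonal; the resulting factorization has real roots and so descends
    to [R]. *)
Lemma symmetric_char_poly_split (R : rcfType) (n : nat) (A : 'M[R]_n) :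
  A^T = A -> exists r : seq R, char_poly A = \prod_(x <- r) ('X - x%:P).
Proof.
move=> Asym; pose toC : {rmorphism R -> R[i]} := real_complex R.
pose B := map_mx toC A.
have Bherm : B \is hermsymmx.
  apply: realsym_hermsym.
    by apply/is_hermitianmxP; rewrite expr0 scale1r map_mx_id // map_trmx Asym.
  by apply/mxOverP=> i j; rewrite mxE complex_real.
pose d := spectral_diag B.
have dreal i : d 0 i = toC (complex.Re (d 0 i)).
  have /mxOverP/(_ 0 i) := hermitian_spectral_diag_real Bherm.
  by move=> /RRe_real.
exists [seq complex.Re (d 0 i) | i <- index_enum 'I_n].
apply: (map_poly_inj toC).
rewrite map_char_poly -/B rmorph_prod /= big_map.
have /hermitian_normalmx/orthomx_spectralP -> := Bherm.
rewrite char_poly_conj ?spectral_unit // char_poly_trig ?diag_mx_is_trig //.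
apply: eq_bigr => i _.
by rewrite mxE eqxx mulr1n map_polyXsubC -dreal.
Qed.

(** A strictly sorted sequence is determined by its elements, so the eigenvalues
    in increasing order are the roots of the characteristic polynomial with
    repetitions removed. *)
Lemma is_ordered_mult_listE (R : realType) (n : nat) (A : 'M[R]_n)
    (r : seq R) (m : seq nat) :
  sorted <=%R r -> char_poly A = \prod_(x <- r) ('X - x%:P) ->
  is_ordered_mult_list A m <-> m = [seq count_mem x r | x <- undup r].
Proof.
move=> ler Ar.
have eigE a : eigenvalue A a = (a \in undup r).
  by rewrite eigenvalue_root_char Ar root_prod_XsubC mem_undup.
have ltr : sorted <%R (undup r).
  rewrite lt_sorted_uniq_le undup_uniq /=.
  exact: subseq_le_sorted (undup_subseq r) ler.
have mupE s : [seq mup a (char_poly A) | a <- s] = [seq count_mem a r | a <- s].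
  by rewrite Ar; apply: eq_map => a; rewrite mu_prod_XsubC.
split=> [[s [lts sE ->]]|->]; last first.
  exists (undup r); split=> [//|a|]; first by rewrite eigE.
  by rewrite mupE.
rewrite mupE; congr map; apply: lt_sorted_eq => // a.
by rewrite sE eigE.
Qed.

(** * Laplacians of the paw *)

Definition paw_laplacian (R : nzRingType) (a b c d : R) : 'M[R]_4 :=
  \matrix_(i, j) nth 0 (nth [::] [:: [:: a + b + d; - a; - b; - d];
                                     [:: - a; a + c; - c; 0];
                                     [:: - b; - c; b + c; 0];
                                     [:: - d; 0; 0; d]] i) j.

(** The weights are the opposites of the entries above the diagonal; the zero
    row sums then fix the diagonal. *)
Lemma SL_PawE (R : realType) (A : 'M[R]_4) :
  SL Paw A <-> exists a b c d : R,
    [/\ 0 < a, 0 < b, 0 < c & 0 < d] /\ A = paw_laplacian a b c d.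
Proof.
split=> [[As Aneg A0 Ad]|[a [b [c [d [[a0 b0 c0 d0] ->]]]]]].
  (* Indexing entries by literals lets the case analysis on ordinals compute. *)
  pose w (i j : nat) := A (inord i) (inord j).
  have wE i j : A i j = w i j by rewrite /w !inord_val.
  have wC i j : w j i = w i j by rewrite /w -{1}As mxE.
  have w0 i j : (i < 4)%N -> (j < 4)%N -> i != j ->
      ((i, j) \notin paw_edges) && ((j, i) \notin paw_edges) -> w i j = 0.
    move=> i4 j4 ij nij; apply: A0; first by rewrite -val_eqE /= !inordK.
    by rewrite /Paw /= /paw_rel /= !inordK // negb_or.
  have wneg i j : (i < 4)%N -> (j < 4)%N -> (i, j) \in paw_edges -> w i j < 0.
    by move=> i4 j4 ij; apply: Aneg; rewrite /Paw /= /paw_rel /= !inordK // ij.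
  have wd i : (i < 4)%N -> w i i = - \sum_(j <- [:: 0; 1; 2; 3]%N | j != i) w i j.
    move=> i4; rewrite {1}/w Ad (_ : [:: 0; 1; 2; 3]%N = index_iota 0 4) //.
    rewrite big_mkord; congr (- _); apply: eq_big => [j|j _].
      by rewrite -val_eqE /= inordK.
    by rewrite wE /= inordK.
  exists (- w 0%N 1%N), (- w 0%N 2%N), (- w 1%N 2%N), (- w 0%N 3%N).
  split; first by split; rewrite oppr_gt0; apply: wneg.
  apply/matrixP=> i j; rewrite mxE wE; move: i j.
  move=> [[|[|[|[|?]]]] ?] [[|[|[|[|?]]]] ?] //=.
  all: rewrite ?wd // ?big_cons ?big_nil /=.
  all: rewrite ?(wC 0 1)%N ?(wC 0 2)%N ?(wC 0 3)%N ?(wC 1 2)%N ?(wC 1 3)%N ?(wC 2 3)%N.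
  all: rewrite ?(w0 1 3)%N ?(w0 2 3)%N //.
  all: try ring.
split.
- by apply/matrixP=> -[[|[|[|[|?]]]] ?] [[|[|[|[|?]]]] ?]; rewrite !mxE.
- move=> -[[|[|[|[|?]]]] ?] [[|[|[|[|?]]]] ?] //=; rewrite !mxE /=;
  by rewrite ?oppr_lt0.
- by move=> -[[|[|[|[|?]]]] ?] [[|[|[|[|?]]]] ?]; rewrite !mxE.
- move=> -[[|[|[|[|?]]]] ?]; rewrite big_mkcond !big_ord_recl big_ord0 !mxE //=.
  all: ring.
Qed.

(** Up to sign, the coefficients count the weighted rooted spanning forests: a
    single edge contributes [2] choices of roots, a pair of adjacent edges [3],
    the disjoint pair [12], [03] contributes [2 * 2], and each spanning tree
    [4]. *)
Lemma char_poly_paw_laplacian (R : comNzRingType) (a b c d : R) :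
  char_poly (paw_laplacian a b c d) =
  'X * ('X ^+ 3 - (2 * (a + b + c + d))%:P * 'X ^+ 2
        + (3 * (a * b + a * c + b * c + a * d + b * d) + 4 * (c * d))%:P * 'X
        - (4 * d * (a * b + a * c + b * c))%:P).
Proof.
have -> : char_poly (paw_laplacian a b c d) = \det (\matrix_(i < 4, j < 4)
    nth 0 (nth [::] [:: [:: 'X - (a + b + d)%:P; a%:P; b%:P; d%:P];
                        [:: a%:P; 'X - (a + c)%:P; c%:P; 0];
                        [:: b%:P; c%:P; 'X - (b + c)%:P; 0];
                        [:: d%:P; 0; 0; 'X - d%:P]] i) j).
  congr (\det _); apply/matrixP=> i j; rewrite !mxE -val_eqE; move: i j.
  by move=> [[|[|[|[|?]]]] ?] [[|[|[|[|?]]]] ?] //=;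
    rewrite ?(mulr1n, mulr0n, sub0r, polyC0, polyCN, opprK, oppr0).
rewrite (det_laplaceE _ (fun i j => nth 0 (nth [::] _ i) j)) /=.
rewrite !(big_cons, big_nil) /= !(polyCD, polyCM, polyC_natr).
ring.
Qed.

Lemma char_poly_paw_laplacian_vieta (R : comNzRingType) (a b c d x y z : R) :
  x + y + z = 2 * (a + b + c + d) ->
  x * y + x * z + y * z
    = 3 * (a * b + a * c + b * c + a * d + b * d) + 4 * (c * d) ->
  x * y * z = 4 * d * (a * b + a * c + b * c) ->
  char_poly (paw_laplacian a b c d) = \prod_(u <- [:: 0; x; y; z]) ('X - u%:P).
Proof.
move=> e1 e2 e3; rewrite char_poly_paw_laplacian -e1 -e2 -e3 !big_cons big_nil.
rewrite polyC0 !(polyCD, polyCM); ring.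
Qed.

(** * Spectra and multiplicity lists of the paw *)

(** The bound [x < z] says that no eigenvalue is triple, which comes down to the
    positivity of [e1 ^ 2 - 3 e2] for the elementary symmetric functions of the
    nonzero eigenvalues. *)
Lemma paw_laplacian_spectrum (R : realType) (a b c d : R) :
  0 < a -> 0 < b -> 0 < c -> 0 < d ->
  exists x y z : R, [/\ 0 < x, x <= y, y <= z & x < z]
    /\ char_poly (paw_laplacian a b c d)
       = \prod_(u <- [:: 0; x; y; z]) ('X - u%:P).
Proof.
move=> a0 b0 c0 d0; set A := paw_laplacian a b c d.
have [r Ar] : exists r : seq R, char_poly A = \prod_(x <- r) ('X - x%:P).
  apply: symmetric_char_poly_split.
  have /SL_PawE[-> //] : exists a b c d : R,
      [/\ 0 < a, 0 < b, 0 < c & 0 < d] /\ A = paw_laplacian a b c d.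
  by exists a, b, c, d.
have r0 : 0 \in r.
  by rewrite -root_prod_XsubC -Ar char_poly_paw_laplacian rootM rootX eqxx.
have := size_char_poly A; rewrite Ar size_prod_XsubC => -[sz].
have prs : perm_eq r (0 :: sort <=%R (rem 0 r)).
  by apply: (perm_trans (perm_to_rem r0)); rewrite perm_cons perm_sym perm_sort.
have sr := sort_le_sorted (rem 0 r).
have szr : size (sort <=%R (rem 0 r)) = 3%N by rewrite size_sort size_rem // sz.
move: Ar; rewrite (perm_big _ prs) /=.
case: (sort _ _) szr sr => [|x [|y [|z [|? ?]]]] //= _ /and3P[xy yz _] Ar.
exists x, y, z; split => //.
have q t : (t - x) * (t - y) * (t - z) = t ^+ 3 - (2 * (a + b + c + d)) * t ^+ 2
    + (3 * (a * b + a * c + b * c + a * d + b * d) + 4 * (c * d)) * t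
    - 4 * d * (a * b + a * c + b * c).
  have := Ar; rewrite char_poly_paw_laplacian big_cons polyC0 subr0.
  move/(mulfI (negbT (polyX_eq0 R)))/(congr1 (fun p => p.[t])).
  rewrite !big_cons big_nil !(hornerD, hornerN, hornerM, hornerXn, hornerX, hornerC).
  by move=> E; rewrite -mulrA -[X in _ * (_ * X)]mulr1 -E.
have ab := mulr_gt0 a0 b0; have ac := mulr_gt0 a0 c0; have bc := mulr_gt0 b0 c0.
have ad := mulr_gt0 a0 d0; have bd := mulr_gt0 b0 d0; have cd := mulr_gt0 c0 d0.
split=> //.
  (* At a root [x <= 0] every term of the cubic would be nonpositive, and the
     constant term negative. *)
  rewrite ltNge; apply/negP=> x0; have := q x; rewrite subrr !mul0r => q0.
  have e3 : 0 < 4 * d * (a * b + a * c + b * c) by rewrite !mulr_gt0 ?addr_gt0.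
  have h3 : x ^+ 3 <= 0 by rewrite exprS mulr_le0_ge0 ?sqr_ge0.
  have h2 : 0 <= 2 * (a + b + c + d) * x ^+ 2.
    by rewrite mulr_ge0 ?sqr_ge0 // mulr_ge0 // ltW // !addr_gt0.
  have h1 : (3 * (a * b + a * c + b * c + a * d + b * d) + 4 * (c * d)) * x <= 0.
    by rewrite mulr_ge0_le0 // ltW // addr_gt0 ?mulr_gt0 ?addr_gt0.
  lra.
rewrite lt_neqAle (le_trans xy yz) andbT; apply/eqP=> xz.
have yx : y = x by apply/le_anti; rewrite xy andbT xz.
(* Three evaluations suffice to identify the coefficients of [(t - x) ^ 3]. *)
have := q 0; have := q 1; have := q (-1); rewrite -xz yx => q1 q2 q3.
have e1 : 2 * (a + b + c + d) = 3 * x by lra.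
have e2 : 3 * (a * b + a * c + b * c + a * d + b * d) + 4 * (c * d) = 3 * x ^+ 2.
  by lra.
have : (2 * (a + b + c + d)) ^+ 2
    = 3 * (3 * (a * b + a * c + b * c + a * d + b * d) + 4 * (c * d)).
  by rewrite e1 e2; ring.
(* [e1 ^ 2 - 3 e2] is a combination of these squares with positive weights. *)
have sq u v : 0 <= (u - v :> R) ^+ 2 by exact: sqr_ge0.
have a2 := mulr_gt0 a0 a0; have b2 := mulr_gt0 b0 b0.
have c2 := mulr_gt0 c0 c0; have d2 := mulr_gt0 d0 d0.
have := sq a b; have := sq a c; have := sq b c; have := sq a d; have := sq b d.
have := sq c d; lra.
Qed.

Lemma paw_mult_listE (R : realType) (A : 'M[R]_4) (x y z : R) (m : seq nat) :
  0 < x -> x <= y -> y <= z -> x < z ->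
  char_poly A = \prod_(u <- [:: 0; x; y; z]) ('X - u%:P) ->
  is_ordered_mult_list A m <->
  m = if x == y then [:: 1; 2; 1]%N
      else if y == z then [:: 1; 1; 2]%N else [:: 1; 1; 1; 1]%N.
Proof.
move=> x0 xy yz xz Ar.
rewrite (is_ordered_mult_listE _ _ Ar) /=; last by rewrite (ltW x0) xy yz.
have y0 := lt_le_trans x0 xy; have z0 := lt_trans x0 xz.
have pos_neq0 :=
  (lt_eqF x0, lt_eqF y0, lt_eqF z0, gt_eqF x0, gt_eqF y0, gt_eqF z0).
have xz_neq := (lt_eqF xz, gt_eqF xz).
rewrite !inE !pos_neq0 /=.
have [eq_xy|neq_xy] := eqVneq x y.
  by rewrite -eq_xy /= !xz_neq /= !eqxx !pos_neq0 !xz_neq.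
have neq_yx : y != x by rewrite eq_sym.
have xy_neq := (negPf neq_xy, negPf neq_yx).
have [eq_yz|neq_yz] := eqVneq y z.
  by rewrite -eq_yz xy_neq /= !eqxx !pos_neq0 !xy_neq.
have neq_zy : z != y by rewrite eq_sym.
have yz_neq := (negPf neq_yz, negPf neq_zy).
by rewrite xz_neq /= !eqxx !pos_neq0 !xy_neq !xz_neq !yz_neq.
Qed.

Lemma attained_Paw (R : realType) (a b c d x y z : R) :
  0 < a -> 0 < b -> 0 < c -> 0 < d ->
  0 < x -> x <= y -> y <= z -> x < z ->
  x + y + z = 2 * (a + b + c + d) ->
  x * y + x * z + y * z
    = 3 * (a * b + a * c + b * c + a * d + b * d) + 4 * (c * d) ->
  x * y * z = 4 * d * (a * b + a * c + b * c) ->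
  attained R Paw (if x == y then [:: 1; 2; 1]%N
      else if y == z then [:: 1; 1; 2]%N else [:: 1; 1; 1; 1]%N).
Proof.
move=> a0 b0 c0 d0 x0 xy yz xz e1 e2 e3; exists (paw_laplacian a b c d); split.
  by apply/SL_PawE; exists a, b, c, d.
by apply/(paw_mult_listE _ x0 xy yz xz); first exact: char_poly_paw_laplacian_vieta.
Qed.

Local Close Scope ring_scope.

Theorem theorem3p6 (R : realType) (m : seq nat) :
  attained R Paw m <->
  m \in [:: [:: 1; 1; 1; 1]; [:: 1; 1; 2]; [:: 1; 2; 1]].
Proof.
split=> [[A [/SL_PawE[a [b [c [d [[a0 b0 c0 d0] ->]]]]]]]|].
  have [x [y [z [[x0 xy yz xz] Ar]]]] := paw_laplacian_spectrum a0 b0 c0 d0.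
  move/(paw_mult_listE _ x0 xy yz xz Ar) => ->.
  by case: (x == y); case: (y == z).
rewrite !inE => /or3P[]/eqP->.
(* With unit weights the eigenvalues are [0, 1, 3, 4]. *)
- have := @attained_Paw R 1%R 1%R 1%R 1%R 1%R 3%R 4%R.
  rewrite !lt_eqF; try lra.
  by apply; lra.
(* With [a = b = d = 2] the eigenvalues other than [0] and [2 + 2 c] are [2] and
   [8]. *)
- have := @attained_Paw R 2%R 2%R 3%R 2%R 2%R 8%R 8%R.
  rewrite lt_eqF ?eqxx; try lra.
  by apply; lra.
(* With [a = b = 4] and [d = 9] the eigenvalues other than [0] and [4 + 2 c] are
   [6] and [24]. *)
- have := @attained_Paw R 4%R 4%R 1%R 9%R 6%R 6%R 24%R.
  rewrite eqxx.
  by apply; lra.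
Qed.
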